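(* Fix the data described in the context (integers $n,m,n_1,\dots,n_m,\alpha$, functions $\varphi_0,\dots,\varphi_m$ with $\varphi_m\equiv1$, the Hamiltonians $h^{(k)}_i$ on $\mathcal M$ and the vector fields $X^{(k)}_i=\pi_0\,dh^{(k)}_i$). Let $s\in\{1,\dots,\alpha\}$ and let $\mathfrak M:\mathcal M\to\mathcal M$ be the Miura map $$\bar\lambda_i=\lambda_i,\quad \bar\mu_i=\lambda_i^{-s}\mu_i\ (i=1,\dots,n),\quad \bar c^{(k)}_i=h^{(k)}_{n_k-i+1}(\boldsymbol\lambda,\boldsymbol\mu,\mathbf c)\ (i=1,\dots,s),\quad \bar c^{(k)}_i=c^{(k)}_i\ (i=s+1,\dots,\alpha),$$ for $k=1,\dots,m$, assumed to define new coordinates $(\bar{\boldsymbol\lambda},\bar{\boldsymbol\mu},\bar{\mathbf c})$ on $\mathcal M$. Let $\bar h^{(k)}_i(\bar{\boldsymbol\lambda},\bar{\boldsymbol\mu},\bar{\mathbf c})$, $i=1,\dots,n_k$, $k=1,\dots,m$, be the functions obtained by solving, for the unknowns $\bar h^{(k)}_i$, the $n$ separation relations ($j=1,\dots,n$) $$\varphi_0(\bar\lambda_j,\bar\lambda_j^s\bar\mu_j)\bar\lambda_j^{-s}+\sum_{k=1}^m\varphi_k(\bar\lambda_j,\bar\mu_j\bar\lambda_j^s)\,\bar\psi_k(\bar\lambda_j)=0,$$ $$\bar\psi_k(\bar\lambda)=\bar c^{(k)}_\alpha\bar\lambda^{n_k+\alpha-s-1}+\dots+\bar c^{(k)}_{s+1}\bar\lambda^{n_k}+\sum_{i=1}^{n_k}\bar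 h^{(k)}_i\bar\lambda^{n_k-i}+\bar c^{(k)}_s\bar\lambda^{-1}+\dots+\bar c^{(k)}_1\bar\lambda^{-s},$$ and let $\bar X^{(k)}_i=\bar\pi\,d\bar h^{(k)}_i$ with $\bar\pi=\sum_{i=1}^n\frac{\partial}{\partial\bar\lambda_i}\wedge\frac{\partial}{\partial\bar\mu_i}$ (in the coordinates $(\bar{\boldsymbol\lambda},\bar{\boldsymbol\mu},\bar{\mathbf c})$). Then, as vector fields on $\mathcal M$, $$X^{(k)}_i=\bar X^{(k)}_i,\qquad i=1,\dots,n_k,\ k=1,\dots,m.$$
   Context: Let $n,m\ge1$, $n_1,\dots,n_m\ge1$ integers with $n_1+\dots+n_m=n$, and $\alpha$ an integer with $1\le\alpha\le\min_k n_k$; set $N=\alpha m$. Let $\varphi_0,\varphi_1,\dots,\varphi_m$ be smooth functions of $(\lambda,\mu)$ with $\varphi_m\equiv1$. Consider the $(n+N)$-parameter algebraic curve $$\varphi_0(\lambda,\mu)+\sum_{k=1}^m\varphi_k(\lambda,\mu)\,\psi_k(\lambda)=0,\qquad \psi_k(\lambda)=c^{(k)}_\alpha\lambda^{n_k-1+\alpha}+\dots+c^{(k)}_1\lambda^{n_k}+\sum_{i=1}^{n_k}a^{(k)}_i\lambda^{n_k-i}.$$ Taking $n$ copies with $(\lambda,\mu)$ replaced by $(\lambda_j,\mu_j)$, $j=1,\dots,n$, and solving (assumed possible on an open domain, with nondegenerate Jacobian with respect to the unknowns) for the $a^{(k)}_i$ gives functions $a^{(k)}_i=h^{(k)}_i(\boldsymbol\lambda,\boldsymbol\mu,\mathbf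 c)$, $i=1,\dots,n_k$, $k=1,\dots,m$. Here $\mathcal M\subset\mathbb{R}^{2n+N}$ is an open set with coordinates $(\boldsymbol\lambda,\boldsymbol\mu,\mathbf c)$, $\mathbf c=(c^{(1)}_1,\dots,c^{(1)}_\alpha,\dots,c^{(m)}_1,\dots,c^{(m)}_\alpha)$. The Poisson tensor $\pi_0=\sum_{i=1}^n\partial_{\lambda_i}\wedge\partial_{\mu_i}$ on $\mathcal M$ has rank $2n$, with the $c^{(k)}_j$ as Casimir functions, and $X^{(k)}_i:=\pi_0\,dh^{(k)}_i$. *)

(* Defs.v *)
From HB Require Import structures.
From mathcomp Require Import all_boot all_order all_algebra.
From mathcomp Require Import all_classical all_reals all_analysis.
Set Implicit Arguments. Unset Strict Implicit. Unset Printing Implicit Defensive.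
Import Order.TTheory GRing.Theory Num.Theory.
Import numFieldNormedType.Exports.
Local Open Scope ring_scope.

(* A point of M ⊂ R^{2n+N}, N = alpha*m : coordinates (lambda, mu, c),
   with c k i = c^{(k)}_{i+1}  (k : 'I_m, i : 'I_alpha, 0-indexed). *)
Definition pt (R : realType) (n m a : nat) :=
  (('rV[R]_n * 'rV[R]_n) * 'M[R]_(m, a))%type.

Section Defs.
Variables (R : realType) (n m a : nat).
Implicit Types (p : pt R n m a).

Definition lam p (j : 'I_n) : R := p.1.1 0 j.
Definition mu p (j : 'I_n) : R := p.1.2 0 j.

Definition e_lam (j : 'I_n) : pt R n m a := ((delta_mx 0 j, 0), 0).
Definition e_mu (j : 'I_n) : pt R n m a := ((0, delta_mx 0 j), 0).

(* Hamiltonian vector field  pi df  for pi = sum_j d/dlambda_j /\ d/dmu_j,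
   written in the coordinates (lambda, mu, c): components
   (df/dmu_j, -df/dlambda_j, 0).  (Any fixed sign convention; the same one is
   used on both sides of the theorem.) *)
Definition ham_vf (f : pt R n m a -> R) p : pt R n m a :=
  ((\row_j ('d f p (e_mu j)), \row_j (- 'd f p (e_lam j))), 0).

(* psi_k(x) = c^{(k)}_alpha x^{n_k-1+alpha} + ... + c^{(k)}_1 x^{n_k}
             + sum_{i=1}^{n_k} a^{(k)}_i x^{n_k-i}
   with unknowns a k i = a^{(k)}_{i+1}. *)
Definition psi (nk : 'I_m -> nat) (c : 'M[R]_(m, a)) (u : 'I_m -> nat -> R)
  (k : 'I_m) (x : R) : R :=
  \sum_(i < a) c k i * x ^+ (nk k + i) +
  \sum_(i < nk k) u k i * x ^+ (nk k - 1 - i).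

Definition sep_rel (phi0 : R -> R -> R) (phi : 'I_m -> R -> R -> R)
  (nk : 'I_m -> nat) p (u : 'I_m -> nat -> R) : Prop :=
  forall j : 'I_n,
    phi0 (lam p j) (mu p j)
    + \sum_(k < m) phi k (lam p j) (mu p j) * psi nk p.2 u k (lam p j) = 0.

(* Jacobian of the separation relations w.r.t. the unknowns a^{(k)}_i
   (entries phi_k(lambda_j,mu_j) lambda_j^{n_k-i}) is nondegenerate:
   this square (n x n, since sum n_k = n) linear map has trivial kernel. *)
Definition jac_nondeg (phi : 'I_m -> R -> R -> R) (nk : 'I_m -> nat) p : Prop :=
  forall u : 'I_m -> nat -> R,
    (forall j : 'I_n, \sum_(k < m) phi k (lam p j) (mu p j) *
        (\sum_(i < nk k) u k i * lam p j ^+ (nk k - 1 - i)) = 0) ->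
    forall (k : 'I_m) (i : nat), (i < nk k)%N -> u k i = 0.

Definition psibar (nk : 'I_m -> nat) (s : nat) (c : 'M[R]_(m, a))
  (u : 'I_m -> nat -> R) (k : 'I_m) (x : R) : R :=
  \sum_(i < a | (s <= i)%N) c k i * x ^+ (nk k + i - s) +
  \sum_(i < nk k) u k i * x ^+ (nk k - 1 - i) +
  \sum_(i < a | (i < s)%N) c k i * x ^- (s - i).

Definition sepbar_rel (phi0 : R -> R -> R) (phi : 'I_m -> R -> R -> R)
  (nk : 'I_m -> nat) (s : nat) (q : pt R n m a) (u : 'I_m -> nat -> R) : Prop :=
  forall j : 'I_n,
    phi0 (lam q j) (lam q j ^+ s * mu q j) * lam q j ^- s
    + \sum_(k < m) phi k (lam q j) (mu q j * lam q j ^+ s)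
                   * psibar nk s q.2 u k (lam q j) = 0.

(* The Miura map: lambdab = lambda, mub_j = lambda_j^{-s} mu_j,
   cb^{(k)}_i = h^{(k)}_{n_k-i+1} (i <= s), cb^{(k)}_i = c^{(k)}_i (i > s).
   With 0-indexing: cb k i = h k (n_k - 1 - i) if i < s. *)
Definition miura (nk : 'I_m -> nat) (s : nat)
  (h : 'I_m -> nat -> pt R n m a -> R) p : pt R n m a :=
  ((p.1.1, \row_j (lam p j ^- s * mu p j)),
   \matrix_(k, i) (if (i < s)%N then h k (nk k - 1 - i)%N p else p.2 k i)).

End Defs.

(* Main.v *)
Require Import Defs.
From HB Require Import structures.
From mathcomp Require Import all_boot all_order all_algebra.
From mathcomp Require Import all_classical all_reals all_analysis.
From mathcomp Require Import ring zify.
Import Order.TTheory GRing.Theory Num.Theory.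
Import numFieldNormedType.Exports.
Local Open Scope classical_set_scope.
Local Open Scope ring_scope.

(* Multiplying the barred separation relation by lambda^s turns it into the
   original curve, evaluated at (lambda, lambda^s mub), with the roles of the
   c's and of the unknowns partly exchanged: by nondegeneracy,
   hb_i o miura = h_(i-s) for i > s and c_(s+1-i) for i <= s.  Hence both
   relations freeze to the same function H(lambda, mu) on each copy, and
   implicit differentiation expresses dh and dhb through the same Jacobian rows
   and the partials of H.  These linear systems give
     dhb/dmub_j = dh/dmu_j,
     dhb/dlambdab_j = lambda_j^-s dh/dlambda_j
                      + s lambda_j^(-s-1) mu_j dh/dmu_j,
   while (dh/dlambda_j, dh/dmu_j) is proportional to the gradient of H at the
   j-th point for every h, so the h's Poisson commute and the new Casimirs are
   preserved by the flow of each h. *)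

(** * Differentials of projections, coordinates, and maps into products and matrices *)

#[local] Instance is_diff_fst (R : realType) (U V : normedModType R) (x : U * V) :
  is_diff x (@fst U V) (@fst U V).
Proof.
have c : continuous (@fst U V) by move=> y; exact: cvg_fst.
by apply: DiffDef; [exact: linear_differentiable|rewrite diff_lin].
Qed.

#[local] Instance is_diff_snd (R : realType) (U V : normedModType R) (x : U * V) :
  is_diff x (@snd U V) (@snd U V).
Proof.
have c : continuous (@snd U V) by move=> y; exact: cvg_snd.
by apply: DiffDef; [exact: linear_differentiable|rewrite diff_lin].
Qed.

Lemma diff_coord (R : realType) m n (A : 'M[R]_(m, n)) i j :
  'd (fun B : 'M[R]_(m, n) => B i j : R) A = (fun B => B i j) :> (_ -> R).
Proof.
have lin : linear (fun B : 'M[R]_(m, n) => B i j : R).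
  by move=> x B C; rewrite !mxE.
pose linM := GRing.isLinear.Build _ _ _ _ _ lin.
pose f : {linear 'M[R]_(m, n) -> R} :=
  HB.pack (fun B : 'M[R]_(m, n) => B i j : R) linM.
by apply: (@diff_lin _ _ _ f); exact: coord_continuous.
Qed.

#[local] Instance is_diff_coord (R : realType) m n (A : 'M[R]_(m, n)) i j :
  is_diff A (fun B : 'M[R]_(m, n) => B i j : R) (fun B => B i j).
Proof. by apply: DiffDef; [exact: differentiable_coord|exact: diff_coord]. Qed.

Lemma sum_pairE (V W : zmodType) n (f : 'I_n -> V * W) :
  \sum_(j < n) f j = (\sum_(j < n) (f j).1, \sum_(j < n) (f j).2).
Proof. by rewrite [LHS]surjective_pairing !raddf_sum. Qed.

Lemma diff_prodE (R : realType) (f : R * R -> R) z x y :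
  'd f z (x, y) = x * 'd f z (1, 0) + y * 'd f z (0, 1).
Proof.
have -> : (x, y) = x *: ((1, 0) : R * R) + y *: ((0, 1) : R * R).
  rewrite [RHS]surjective_pairing/= !scaler0 addr0 add0r.
  by rewrite -[x *: _]/(x * 1) -[y *: _]/(y * 1) !mulr1.
by rewrite linearD !linearZ.
Qed.

Section Differentials.
Context {R : realType}.

Lemma differentiable_mx (V : normedModType R) m n (f : V -> 'M[R]_(m, n)) x :
  (forall i j, differentiable (fun y => f y i j : R) x) -> differentiable f x.
Proof.
move=> df.
rewrite (_ : f = \sum_(i < m) \sum_(j < n) (fun y => f y i j *: delta_mx i j)).
  by do 2!apply: differentiable_sum => ?; exact: differentiableZl.
apply/funext => y; rewrite fct_sumE [LHS]matrix_sum_delta.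
by apply: eq_bigr => i _; rewrite fct_sumE.
Qed.

Lemma diff_mxE (V : normedModType R) m n (f : V -> 'M[R]_(m, n)) x v i j :
  differentiable f x -> ('d f x v) i j = 'd (fun y => f y i j : R) x v.
Proof.
move=> df; rewrite -[RHS]/('d ((fun B : 'M[R]_(m, n) => B i j : R) \o f) x v).
by rewrite [in RHS](diff_comp df) ?diff_coord//; exact: differentiable_coord.
Qed.

Lemma diff_pairE (U V W : normedModType R) (f : U -> V * W) x v :
  differentiable f x ->
  'd f x v = ('d (fun y => (f y).1) x v, 'd (fun y => (f y).2) x v).
Proof.
move=> df; rewrite -[X in (X, _)]/('d (fst \o f) x v).
rewrite -[X in (_, X)]/('d (snd \o f) x v) !(diff_comp df)//= !diff_val.
exact: surjective_pairing.
Qed.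

(** Exponent 0 must be allowed: it occurs in the constant terms of the polynomials below. *)
Lemma differentiable_exprn (V : normedModType R) (f : V -> R) l x :
  differentiable f x -> differentiable (f ^+ l) x.
Proof.
move=> df; case: l => [|l]; last exact: differentiableX.
by rewrite expr0; exact: differentiable_cst.
Qed.

Variables (V : normedModType R) (x v : V).

Lemma is_derive_fsum n (h : 'I_n -> V -> R) (dh : 'I_n -> R) :
  (forall i, is_derive x v (h i) (dh i)) ->
  is_derive x v (fun y => \sum_(i < n) h i y) (\sum_(i < n) dh i).
Proof.
move=> dhP; rewrite (_ : (fun _ => _) = \sum_(i < n) h i).
  exact: is_derive_sum.
by apply/funext => y; rewrite fct_sumE.
Qed.

(** In the Leibniz rule the derivative of [f] is multiplied by [g x = 0], so its value need not be
    known. *)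
Lemma is_derive_mul_vanishing (f g : V -> R) (dg : R) :
  derivable f x v -> is_derive x v g dg -> g x = 0 ->
  is_derive x v (fun y => f y * g y) (f x * dg).
Proof.
move=> /derivableP fP gP g0; apply: is_derive_eq.
by rewrite g0 scale0r addr0.
Qed.

Lemma is_derive_mul_increment (f g : V -> R) :
  derivable f x v -> derivable g x v ->
  is_derive x v (fun y => f y * (g y - g x)) (f x * 'D_v g x).
Proof.
move=> fP /derivableP gP; apply: is_derive_mul_vanishing => //.
- by apply: is_derive_eq (subr0 _).
- exact: subrr.
Qed.

End Differentials.

(** * Implicit differentiation of a separation relation *)

Section Linearization.
Context {R : realType} {n m a : nat}.
Variables (nk : 'I_m -> nat) (phi0 : R -> R -> R) (phi : 'I_m -> R -> R -> R).
Hypothesis phi0_diff :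
  forall z : R * R, differentiable (fun w : R * R => phi0 w.1 w.2) z.
Hypothesis phi_diff :
  forall k (z : R * R), differentiable (fun w : R * R => phi k w.1 w.2) z.

Definition curve (W : 'I_m -> R -> R) (z : R * R) : R :=
  phi0 z.1 z.2 + \sum_(k < m) phi k z.1 z.2 * W k z.1.

(* Common shape of [psi] and of [x ^+ s * psibar]; the coefficient lists are kept
   separate since [c] is constant along Hamiltonian fields. *)
Definition sparse_poly (e d : 'I_m -> nat -> nat) (c : 'M[R]_(m, a))
    (u : 'I_m -> nat -> R) (k : 'I_m) (x : R) : R :=
  \sum_(i < a) c k i * x ^+ e k i + \sum_(i < nk k) u k i * x ^+ d k i.

Lemma differentiable_curve (W : 'I_m -> R -> R) z :
  (forall k, differentiable (W k) z.1) -> differentiable (curve W) z.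
Proof.
move=> dW; apply: differentiableD => //.
rewrite (_ : (fun _ => _) =
  \sum_(k < m) ((fun w => phi k w.1 w.2) * (W k \o fst))).
  apply: differentiable_sum => k; apply: differentiableM => //.
  exact: differentiable_comp.
by apply/funext => w; rewrite fct_sumE.
Qed.

Lemma differentiable_sparse_poly e d c u k x :
  differentiable (sparse_poly e d c u k) x.
Proof.
rewrite (_ : sparse_poly _ _ _ _ _ =
    \sum_(i < a) (c k i *: (@id R) ^+ e k i) +
    \sum_(i < nk k) (u k i *: (@id R) ^+ d k i)).
  by apply: differentiableD; apply: differentiable_sum => i;
    apply: differentiableZ; exact: (@differentiable_exprn _ _ (@id R)).
by apply/funext => y; rewrite /sparse_poly fctE !fct_sumE; congr (_ + _);
  apply: eq_bigr => i _; rewrite fctE.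
Qed.

(** A relation valid near [p] has zero derivative along [v]. Since [v] has no [c]-component, only
    the unknowns and the point [Psi] move, which leaves one linear equation for the
    ['d (u k i) p v]. A general [Psi] covers both [(lam, mu)] and [(lam, lam ^+ s * mu)]. *)
Lemma linearized_relation e d (u : 'I_m -> nat -> pt R n m a -> R)
    (Psi : pt R n m a -> R * R) (p v : pt R n m a) :
  differentiable Psi p ->
  (forall k i, (i < nk k)%N -> differentiable (u k i) p) ->
  v.2 = 0 ->
  (\near p, curve (sparse_poly e d p.2 (fun k i => u k i p)) (Psi p) = 0) ->
  \sum_(k < m) phi k (Psi p).1 (Psi p).2 *
      (\sum_(i < nk k) 'd (u k i) p v * (Psi p).1 ^+ d k i) =
  - 'd (curve (sparse_poly e d p.2 (fun k i => u k i p))) (Psi p) ('d Psi p v).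
Proof.
move=> dPsi du v0 rel0.
set H := curve _.
have dH : differentiable H (Psi p).
  by apply: differentiable_curve => k; exact: differentiable_sparse_poly.
have dX l : derivable (fun q => (Psi q).1 ^+ l) p v.
  rewrite (_ : (fun _ => _) = (fst \o Psi) ^+ l); last first.
    by apply/funext => q; rewrite exprfctE.
  apply: diff_derivable; apply: differentiable_exprn.
  exact: differentiable_comp.
(* The error at the moving point [Psi q] made by freezing the coefficients at their values at
   [p]. *)
pose r k q : R :=
  \sum_(i < a) (Psi q).1 ^+ e k i * (q.2 k i - p.2 k i) +
  \sum_(i < nk k) (Psi q).1 ^+ d k i * (u k i q - u k i p).
have rp k : r k p = 0.
  by rewrite /r !big1 ?addr0// => i _; rewrite subrr mulr0.
have dr k : is_derive p v (r k)
    (\sum_(i < nk k) (Psi p).1 ^+ d k i * 'd (u k i) p v).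
  rewrite -[X in is_derive _ _ _ X]add0r; apply: is_deriveD; last first.
    apply: is_derive_fsum => i; rewrite -deriveE; last exact: du.
    by apply: is_derive_mul_increment => //; exact/diff_derivable/du.
  apply: (@is_derive_eq _ _ _ _ _ _ _ (\sum_(i < a) 0)); last exact: big1_eq.
  apply: is_derive_fsum => i.
  have dc : is_diff p (fun q : pt R n m a => q.2 k i : R) (fun q => q.2 k i).
    exact: (@is_diff_comp _ _ _ _ (@snd _ _) _ (fun B : 'M[R]_(m, a) => B k i)).
  have d0 : 'D_v (fun q : pt R n m a => q.2 k i : R) p = 0.
    by rewrite deriveE// diff_val v0 mxE.
  rewrite -[X in is_derive _ _ _ X](mulr0 ((Psi p).1 ^+ e k i)) -d0.
  by apply: is_derive_mul_increment => //; exact: diff_derivable.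
(* The increments of the coefficients vanish at [p], so only their derivatives
   survive there, multiplied by the frozen factors. *)
have splitE q : curve (sparse_poly e d q.2 (fun k i => u k i q)) (Psi q) =
    H (Psi q) + \sum_(k < m) phi k (Psi q).1 (Psi q).2 * r k q.
  rewrite /H /curve -addrA -big_split/=; congr (_ + _).
  apply: eq_bigr => k _; rewrite -mulrDr; congr (_ * _).
  rewrite /sparse_poly /r addrACA -!big_split/=.
  by congr (_ + _); apply: eq_bigr => i _; ring.
(* One function is differentiated twice: it vanishes near [p], and its derivative can also be
   computed termwise; comparing the two gives the claim. *)
have D0 : is_derive p v (fun q => H (Psi q) +
    \sum_(k < m) phi k (Psi q).1 (Psi q).2 * r k q) 0.
  apply: (near_eq_is_derive _ (is_derive_cst 0 p v)).
  by near=> q; rewrite -splitE; apply/esym; near: q.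
have D1 : is_derive p v (fun q => H (Psi q) +
    \sum_(k < m) phi k (Psi q).1 (Psi q).2 * r k q)
    ('d H (Psi p) ('d Psi p v) + \sum_(k < m) phi k (Psi p).1 (Psi p).2 *
      (\sum_(i < nk k) (Psi p).1 ^+ d k i * 'd (u k i) p v)).
  apply: is_deriveD.
    rewrite -[X in is_derive _ _ _ X]/(('d H (Psi p) \o 'd Psi p) v).
    rewrite -diff_comp// -deriveE; last exact: differentiable_comp.
    by apply: derivableP; apply: diff_derivable; exact: differentiable_comp.
  apply: is_derive_fsum => k; apply: is_derive_mul_vanishing => //.
  apply: diff_derivable.
  by apply: (@differentiable_comp _ _ _ _ Psi (fun w => phi k w.1 w.2)).
have := @derive_val _ _ _ _ _ _ _ D0.
rewrite (@derive_val _ _ _ _ _ _ _ D1) => /eqP.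
rewrite addrC addr_eq0 => /eqP <-; apply: eq_bigr => k _.
by congr (_ * _); apply: eq_bigr => i _; rewrite mulrC.
Unshelve. all: by end_near. Qed.

End Linearization.

(** * Exchange of Casimirs and Hamiltonians inside the polynomials *)

Section PolynomialIdentity.
Context {R : realType} {m a : nat}.
Variables (nk : 'I_m -> nat) (s : nat).

(* Exponents of [x ^+ s * psibar nk s c u k x]: no negative power is left. *)
Definition expc (k : 'I_m) (i : nat) := if (s <= i)%N then (nk k + i)%N else i.
Definition expu (k : 'I_m) (i : nat) := (nk k - 1 - i + s)%N.

Lemma psibar_sparse_poly (c : 'M[R]_(m, a)) u k x : x != 0 ->
  x ^+ s * psibar nk s c u k x = sparse_poly nk expc expu c u k x.
Proof.
move=> x0; rewrite /psibar /sparse_poly addrAC mulrDr; congr (_ + _).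
  rewrite mulrDr [RHS](bigID (fun i : 'I_a => s <= i)%N)/= !mulr_sumr.
  congr (_ + _).
    apply: eq_bigr => i si; rewrite /expc si mulrCA -exprD subnKC//.
    exact: leq_trans si (leq_addl _ _).
  rewrite [LHS](eq_bigl (fun i : 'I_a => ~~ (s <= i)%N)); last first.
    by move=> i; rewrite ltnNge.
  apply: eq_bigr => i si; rewrite /expc (negbTE si) mulrCA; congr (_ * _).
  (* Here [x ^+ s * x ^- (s - i) = x ^+ (s - (s - i)) = x ^+ i]. *)
  by rewrite -expfB_cond ?(negbTE x0) ?leq_subr// subKn// ltnW// ltnNge.
rewrite mulr_sumr; apply: eq_bigr => i _.
by rewrite mulrCA -exprD addnC.
Qed.

(* [C] extends [c k] to [nat], which makes [s - 1 - i] usable as an index. *)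
Lemma sparse_poly_swap (c cb : 'M[R]_(m, a)) (u ub : 'I_m -> nat -> R)
    (C : nat -> R) k x :
  (s <= a)%N -> (s <= nk k)%N ->
  (forall i : 'I_a, c k i = C i) ->
  (forall i : 'I_a, cb k i = if (i < s)%N then u k (nk k - 1 - i)%N else c k i) ->
  (forall i, ub k i = if (i < s)%N then C (s - 1 - i)%N else u k (i - s)%N) ->
  sparse_poly nk expc expu cb ub k x = psi nk c u k x.
Proof.
move=> sa sn cE cbE ubE; rewrite /sparse_poly /psi.
(* The [cb] sum after substitution: powers below [s] carry old Hamiltonians, the others keep their
   Casimirs. *)
pose F i := if (i < s)%N then u k (nk k - 1 - i)%N * x ^+ i
            else C i * x ^+ (nk k + i).
rewrite (eq_bigr (fun i : 'I_a => F i)); last first.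
  by move=> i _; rewrite cbE cE /expc /F; case: (leqP s i).
rewrite [X in _ = X + _](eq_bigr (fun i : 'I_a => C i * x ^+ (nk k + i)));
  last by move=> i _; rewrite cE.
rewrite -(big_mkord xpredT F).
rewrite -(big_mkord xpredT (fun i => C i * x ^+ (nk k + i))).
rewrite -(big_mkord xpredT (fun i => ub k i * x ^+ expu k i)).
rewrite -(big_mkord xpredT (fun i => u k i * x ^+ (nk k - 1 - i))).
(* All four sums are cut at [s], the [u] sum after reversal so that its index is the power of [x].
   The blocks then pair off: low [cb] with low powers of [u], low [ub] with low [c], high [ub] with
   the remaining [u], high [cb] with high [c]. *)
rewrite !(@big_cat_nat _ _ _ s 0 a)//= (@big_cat_nat _ _ _ s 0 (nk k))//=.
rewrite [X in _ = _ + X]big_nat_rev/= add0n.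
rewrite [X in _ = _ + X](@big_cat_nat _ _ _ s 0 (nk k))//=.
rewrite addrACA [RHS]addrC [RHS]addrACA [X in _ + X = _]addrC.
congr (_ + _ + (_ + _)).
- rewrite !big_nat; apply: eq_bigr => i /= si; rewrite /F si.
  by congr (u k _ * x ^+ _); lia.
- rewrite [LHS]big_nat_rev/= add0n !big_nat; apply: eq_bigr => i /= si.
  rewrite ubE ifT; last by lia.
  by rewrite /expu; congr (C _ * x ^+ _); lia.
- rewrite [LHS]big_nat_rev/= !big_nat; apply: eq_bigr => i /= si.
  rewrite ubE ifF; last by lia.
  by rewrite /expu; congr (u k _ * x ^+ _); lia.
- rewrite !big_nat; apply: eq_bigr => i /= si.
  by rewrite /F ifF//; lia.
Qed.

End PolynomialIdentity.

(** * Rows of the Jacobian with respect to the unknowns *)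

Section JacobianRows.
Context {R : realType} {n m a : nat}.
Variables (phi : 'I_m -> R -> R -> R) (nk : 'I_m -> nat) (p : pt R n m a).

(** Convertible to the expression whose vanishing is assumed in [jac_nondeg], so that hypothesis
    applies to it directly. *)
Definition jac_row (u : 'I_m -> nat -> R) (j : 'I_n) : R :=
  \sum_(k < m) phi k (lam p j) (mu p j) *
    (\sum_(i < nk k) u k i * lam p j ^+ (nk k - 1 - i)).

Lemma jac_row_comb x y u v j :
  jac_row (fun k i => x * u k i + y * v k i) j =
  x * jac_row u j + y * jac_row v j.
Proof.
rewrite /jac_row !mulr_sumr -big_split; apply: eq_bigr => k _ /=.
rewrite 2![_ * (phi _ _ _ * _)]mulrCA -mulrDr; congr (_ * _).
by rewrite !mulr_sumr -big_split; apply: eq_bigr => i _ /=; ring.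
Qed.

(** Reduces identities between [hb] and [h], or between their differentials, to scalar identities,
    one per copy of the curve. *)
Lemma jac_row_inj u v : jac_nondeg phi nk p ->
  (forall j, jac_row u j = jac_row v j) ->
  forall k i, (i < nk k)%N -> u k i = v k i.
Proof.
move=> nondeg uv k i ik; apply/subr0_eq.
rewrite -[u k i]mul1r -mulN1r.
apply: (nondeg (fun k i => 1 * u k i + -1 * v k i)) => // j.
by have := jac_row_comb 1 (-1) u v j; rewrite uv mul1r mulN1r subrr.
Qed.

End JacobianRows.

(** * Differentials of the Miura coordinates, and Hamiltonian vector fields *)

Section Coordinates.
Context {R : realType} {n m a : nat}.
Implicit Types p v : pt R n m a.

#[local] Instance is_diff_lam p j :
  is_diff p (fun q : pt R n m a => lam q j) (fun q => lam q j).
Proof.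
exact: (@is_diff_comp _ _ _ _ (fst \o fst) _ (fun B : 'rV[R]_n => B 0 j)).
Qed.

#[local] Instance is_diff_mu p j :
  is_diff p (fun q : pt R n m a => mu q j) (fun q => mu q j).
Proof.
exact: (@is_diff_comp _ _ _ _ (snd \o fst) _ (fun B : 'rV[R]_n => B 0 j)).
Qed.

(** At [s = 0] the truncated exponent [s.-1] is harmless, being multiplied by [s%:R = 0]. *)
Lemma diff_expr_lam_mu s p v j :
  'd (fun q : pt R n m a => lam q j ^+ s * mu q j) p v =
  lam p j ^+ s * mu v j + s%:R * lam p j ^+ s.-1 * mu p j * lam v j.
Proof.
case: s => [|s].
  rewrite (_ : (fun _ => _) = fun q : pt R n m a => mu q j); last first.
    by apply/funext => q; rewrite expr0 mul1r.
  by rewrite diff_val expr0 mul1r !mul0r addr0.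
rewrite (_ : (fun _ => _) =
    (fun q : pt R n m a => lam q j) ^+ s.+1 * (fun q : pt R n m a => mu q j)).
  by rewrite diff_val !fctE /GRing.scale/=; ring.
by apply/funext => q; rewrite !fctE.
Qed.

Lemma differentiable_expr_lam_mu s p j :
  differentiable (fun q : pt R n m a => lam q j ^+ s * mu q j) p.
Proof.
rewrite (_ : (fun _ => _) =
    (fun q : pt R n m a => lam q j) ^+ s * (fun q : pt R n m a => mu q j)).
  by apply: differentiableM => //; exact: differentiable_exprn.
by apply/funext => q; rewrite !fctE.
Qed.

Lemma differentiable_exprN_lam_mu s p j : lam p j != 0 ->
  differentiable (fun q : pt R n m a => lam q j ^- s * mu q j) p.
Proof.
move=> x0.
rewrite (_ : (fun _ => _) =
  (fun q => (((fun q : pt R n m a => lam q j) ^+ s) q)^-1) *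
  (fun q : pt R n m a => mu q j)).
  apply: differentiableM => //; apply: differentiableV.
    exact: differentiable_exprn.
  by rewrite exprfctE expf_neq0.
by apply/funext => q; rewrite !fctE.
Qed.

Lemma diff_exprN_lam_mu s p v j : lam p j != 0 ->
  'd (fun q : pt R n m a => lam q j ^- s * mu q j) p v =
  lam p j ^- s * mu v j - s%:R * (lam p j)^-1 * lam p j ^- s * mu p j * lam v j.
Proof.
move=> x0; case: s => [|s].
  rewrite (_ : (fun _ => _) = fun q : pt R n m a => mu q j); last first.
    by apply/funext => q; rewrite expr0 invr1 mul1r.
  by rewrite diff_val expr0 invr1 mul1r !mul0r subr0.
rewrite (_ : (fun _ => _) =
  (fun q => (((fun q : pt R n m a => lam q j) ^+ s.+1) q)^-1) *
  (fun q : pt R n m a => mu q j)); last by apply/funext => q; rewrite !fctE.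
rewrite diffM//; last first.
  apply: differentiableV; first exact: differentiable_exprn.
  by rewrite exprfctE expf_neq0.
rewrite diffV ?diff_val//=; last by rewrite exprfctE expf_neq0.
rewrite !fctE -[LHS]/((lam p j ^+ s.+1)^-1 * mu v j +
  mu p j * (- (lam p j ^+ s.+1) ^- 2 * (s.+1%:R * lam p j ^+ s * lam v j))).
rewrite exprS; field.
by rewrite x0 expf_neq0.
Qed.

Lemma diff_lamE p v j : 'd (fun q : pt R n m a => lam q j) p v = lam v j.
Proof. by rewrite diff_val. Qed.

Lemma diff_lam_expr_lam_mu s p v j :
  'd (fun q : pt R n m a => (lam q j, lam q j ^+ s * mu q j)) p v =
  (lam v j,
   lam p j ^+ s * mu v j + s%:R * lam p j ^+ s.-1 * mu p j * lam v j).
Proof.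
rewrite diff_pairE/=; last first.
  by apply: differentiable_pair => //; exact: differentiable_expr_lam_mu.
by rewrite diff_lamE diff_expr_lam_mu.
Qed.

Lemma differentiable_lam_expr_lam_mu s p j :
  differentiable (fun q : pt R n m a => (lam q j, lam q j ^+ s * mu q j)) p.
Proof.
by apply: differentiable_pair => //; exact: differentiable_expr_lam_mu.
Qed.

Lemma differentiable_lam_mu p j :
  differentiable (fun q : pt R n m a => (lam q j, mu q j)) p.
Proof. exact: differentiable_pair. Qed.

Lemma diff_lam_mu p v j :
  'd (fun q : pt R n m a => (lam q j, mu q j)) p v = (lam v j, mu v j).
Proof.
by rewrite diff_pairE ?diff_val//; exact: differentiable_lam_mu.
Qed.

Lemma lam_e_lam i j : lam (e_lam R m a i : pt R n m a) j = (j == i)%:R.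
Proof. by rewrite /lam /= mxE eqxx. Qed.

Lemma mu_e_lam i j : mu (e_lam R m a i : pt R n m a) j = 0.
Proof. by rewrite /mu /= mxE. Qed.

Lemma lam_e_mu i j : lam (e_mu R m a i : pt R n m a) j = 0.
Proof. by rewrite /lam /= mxE. Qed.

Lemma mu_e_mu i j : mu (e_mu R m a i : pt R n m a) j = (j == i)%:R.
Proof. by rewrite /mu /= mxE eqxx. Qed.

Lemma lam_ham_vf f p j : lam (ham_vf f p) j = 'd f p (e_mu R m a j).
Proof. by rewrite /lam /ham_vf/= mxE. Qed.

Lemma mu_ham_vf f p j : mu (ham_vf f p) j = - 'd f p (e_lam R m a j).
Proof. by rewrite /mu /ham_vf/= mxE. Qed.

Lemma ham_vf_sum f p : ham_vf f p =
  \sum_(j < n) ('d f p (e_mu R m a j) *: e_lam R m a j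
                - 'd f p (e_lam R m a j) *: e_mu R m a j).
Proof.
rewrite sum_pairE sum_pairE/= /ham_vf.
congr (_, _, _).
- rewrite [LHS]row_sum_delta; apply: eq_bigr => j _.
  by rewrite mxE scaler0 subr0.
- rewrite [LHS]row_sum_delta; apply: eq_bigr => j _.
  by rewrite mxE scaler0 add0r scaleNr.
- by rewrite big1// => j _; rewrite !scaler0 subr0.
Qed.

(** The sum is the canonical Poisson bracket of [f] and [g], in the sign convention of [ham_vf]. *)
Lemma diff_ham_vf (f g : pt R n m a -> R) p :
  'd g p (ham_vf f p) =
  \sum_(j < n) ('d f p (e_mu R m a j) * 'd g p (e_lam R m a j)
                - 'd f p (e_lam R m a j) * 'd g p (e_mu R m a j)).
Proof.
rewrite ham_vf_sum linear_sum; apply: eq_bigr => j _.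
by rewrite linearB !linearZ.
Qed.

End Coordinates.

(** * Separation relations expressed through the curve and the Jacobian rows *)

Section Relations.
Context {R : realType} {n m a : nat}.
Variables (nk : 'I_m -> nat) (phi0 : R -> R -> R) (phi : 'I_m -> R -> R -> R).
Variable (s : nat).
Implicit Types p q : pt R n m a.

Lemma jac_row_shift p (u : 'I_m -> nat -> R) (j : 'I_n) :
  \sum_(k < m) phi k (lam p j) (mu p j) *
    (\sum_(i < nk k) u k i * lam p j ^+ expu nk s k i) =
  lam p j ^+ s * jac_row phi nk p u j.
Proof.
rewrite /jac_row mulr_sumr; apply: eq_bigr => k _.
rewrite [RHS]mulrCA; congr (_ * _).
by rewrite mulr_sumr; apply: eq_bigr => i _; rewrite /expu exprD mulrA mulrC.
Qed.

(** The relation is affine in the unknowns and only the last term contains [u]. Hence two solutions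
    with the same [c] have equal Jacobian rows wherever [lam p j] is nonzero. *)
Lemma curve_sparse_poly_jac_row p e (c : 'M[R]_(m, a)) (u : 'I_m -> nat -> R)
    (j : 'I_n) :
  curve phi0 phi (sparse_poly nk e (expu nk s) c u)
    (lam p j, mu p j) =
  phi0 (lam p j) (mu p j) +
  \sum_(k < m) phi k (lam p j) (mu p j) *
    (\sum_(i < a) c k i * lam p j ^+ e k i) +
  lam p j ^+ s * jac_row phi nk p u j.
Proof.
rewrite -jac_row_shift /curve -addrA -big_split/=; congr (_ + _).
by apply: eq_bigr => k _; rewrite -mulrDr.
Qed.

Lemma sepbar_rel_curve q u (j : 'I_n) : lam q j != 0 ->
  sepbar_rel phi0 phi nk s q u ->
  curve phi0 phi (sparse_poly nk (expc nk s) (expu nk s) q.2 u)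
    (lam q j, lam q j ^+ s * mu q j) = 0.
Proof.
move=> x0 /(_ j) /(congr1 ( *%R (lam q j ^+ s))).
rewrite mulr0 mulrDr mulrCA mulfV ?expf_neq0// mulr1 mulr_sumr => E.
rewrite -[RHS]E /curve/=; congr (_ + _); apply: eq_bigr => k _.
by rewrite -psibar_sparse_poly// mulrCA [mu q j * _]mulrC.
Qed.

End Relations.

(** If [(A, B)] is nonzero, both [(a, b)] and [(a', b')] are multiples of it, so their determinant
    vanishes. If it is zero, the premises hold for all [x] and [y] and force both pairs to
    vanish. *)
Lemma det_annihilated_eq0 (F : fieldType) (A B a b a' b' : F) :
  (forall x y, x * A + y * B = 0 -> x * a + y * b = 0) ->
  (forall x y, x * A + y * B = 0 -> x * a' + y * b' = 0) ->
  b * a' - a * b' = 0.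
Proof.
move=> ann ann'.
have BA : B * A + - A * B = 0 by rewrite mulNr mulrC subrr.
have /eqP := ann _ _ BA; rewrite mulNr subr_eq0 => /eqP Eab.
have /eqP := ann' _ _ BA; rewrite mulNr subr_eq0 => /eqP Eab'.
have [A0|A0] := eqVneq A 0; last first.
  apply: (mulfI A0); rewrite mulr0 mulrBr mulrA -Eab [A * (_ * b')]mulrCA -Eab'.
  by ring.
have [B0|B0] := eqVneq B 0; last first.
  apply: (mulfI B0); rewrite mulr0 mulrBr [X in X - _]mulrCA Eab'.
  rewrite [X in _ - X]mulrA Eab A0.
  by ring.
have AB : 1 * A + 0 * B = 0 by rewrite A0 mulr0 mul0r addr0.
have := ann _ _ AB; rewrite mul0r mul1r addr0 => ->.
have := ann' _ _ AB; rewrite mul0r mul1r addr0 => ->.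
by ring.
Qed.

(** * Comparison of the two families of vector fields *)

Theorem theorem12 (R : realType) (n m : nat) (nk : 'I_m -> nat) (alpha : nat)
  (phi0 : R -> R -> R) (phi : 'I_m -> R -> R -> R)
  (M : set (pt R n m alpha))
  (h hb : 'I_m -> nat -> pt R n m alpha -> R) (s : nat) :
  (0 < n)%N -> (0 < m)%N ->
  (forall k, 0 < nk k)%N ->
  (\sum_(k < m) nk k)%N = n ->
  (1 <= alpha)%N -> (forall k, alpha <= nk k)%N ->
  (forall z : R * R, differentiable (fun w : R * R => phi0 w.1 w.2) z) ->
  (forall k (z : R * R), differentiable (fun w : R * R => phi k w.1 w.2) z) ->
  (forall k : 'I_m, val k = m.-1 -> forall x y, phi k x y = 1) ->
  open M ->
  (forall p, M p -> forall j, lam p j != 0) ->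
  (forall p, M p -> jac_nondeg phi nk p) ->
  (forall p, M p -> sep_rel phi0 phi nk p (fun k i => h k i p)) ->
  (forall p, M p -> forall k i, (i < nk k)%N -> differentiable (h k i) p) ->
  (1 <= s <= alpha)%N ->
  {in M &, injective (miura nk s h)} ->
  open (miura nk s h @` M) ->
  (forall p, M p -> injective ('d (miura nk s h) p)) ->
  (forall q, (miura nk s h @` M) q ->
     sepbar_rel phi0 phi nk s q (fun k i => hb k i q)) ->
  (forall q, (miura nk s h @` M) q ->
     forall k i, (i < nk k)%N -> differentiable (hb k i) q) ->
  forall (k : 'I_m) (i : nat), (i < nk k)%N ->
  forall p, M p ->
    'd (miura nk s h) p (ham_vf (h k i) p) = ham_vf (hb k i) (miura nk s h p).
Proof.
move=> _ _ _ _ _ ank dphi0 dphi _ oM lam_neq0 nondeg rel dh /andP[_ sa] _ oMb _.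
move=> relb dhb k i ik p Mp.
have sn k' : (s <= nk k')%N by exact: leq_trans (ank k').
set q := miura nk s h p.
have Mq : (miura nk s h @` M) q by exists p.
have q_lam j : lam q j = lam p j by [].
have q_muE j : mu q j = lam p j ^- s * mu p j by rewrite /mu /= mxE.
have q_mu j : lam p j ^+ s * mu q j = mu p j.
  by rewrite q_muE mulVKf// expf_neq0//; exact: lam_neq0.
pose W := psi nk p.2 (fun k i => h k i p).
have HW j : curve phi0 phi W (lam p j, mu p j) = 0 by exact: rel.
(* Both systems freeze to the same polynomials, hence to the same curve function. *)
have WE : sparse_poly nk (expc nk s) (expu nk s) q.2 (fun k i => hb k i q) = W.
  (* The default 0 is never read by [ub]: there [C] is taken at [s - 1 - i'], which is below
     [s <= alpha]. *)
  pose C k' i' : R := oapp (p.2 k') 0 (insub i').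
  pose ub k' i' :=
    if (i' < s)%N then C k' (s - 1 - i')%N else h k' (i' - s)%N p.
  have ubW : sparse_poly nk (expc nk s) (expu nk s) q.2 ub = W.
    apply/funext => k'; apply/funext => x.
    apply: (@sparse_poly_swap _ _ _ _ _ _ _ _ _ (C k')) => //.
    - by move=> i'; rewrite /C valK.
    - by move=> i'; rewrite /= mxE.
  (* [hb] at [q] and [ub] solve the same relations with the same Casimirs [q.2], so nondegeneracy
     identifies them. *)
  have hb_ub : forall k' i', (i' < nk k')%N -> hb k' i' q = ub k' i'.
    apply: (jac_row_inj _ _ _ _ _ (nondeg p Mp)) => j.
    have x0 := lam_neq0 p Mp j.
    have := @sepbar_rel_curve _ _ _ _ nk phi0 phi s q _ j x0 (relb q Mq).
    rewrite q_lam q_mu -[RHS](HW j) -ubW !curve_sparse_poly_jac_row => E.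
    by apply: (mulfI (expf_neq0 s x0)); exact: addrI E.
  rewrite -ubW; apply/funext => k'; apply/funext => x; congr (_ + _).
  by apply: eq_bigr => i' _; rewrite hb_ub.
clearbody q.
pose A j := 'd (curve phi0 phi W) (lam p j, mu p j) (1, 0).
pose B j := 'd (curve phi0 phi W) (lam p j, mu p j) (0, 1).
have FE j (x y : R) :
    'd (curve phi0 phi W) (lam p j, mu p j) (x, y) = x * A j + y * B j.
  exact: diff_prodE.
have rowh (v : pt R n m alpha) j : v.2 = 0 ->
    jac_row phi nk p (fun k i => 'd (h k i) p v) j =
    - (lam v j * A j + mu v j * B j).
  move=> v0.
  have := linearized_relation nk phi0 phi dphi0 dphi
    (fun k i => nk k + i)%N (fun k i => nk k - 1 - i)%N h _ p v
    (differentiable_lam_mu p j) (dh p Mp) v0.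
  rewrite diff_lam_mu -FE; apply.
  have : nbhs p M by exact: open_nbhs_nbhs.
  by apply: filterS => p' Mp'; exact: rel.
(* By [WE], the partials [A j] and [B j] are those of [rowh]; only the chain rule through
   [mu = lam ^+ s * mub] differs. *)
have rowhb (v : pt R n m alpha) j : v.2 = 0 ->
    lam p j ^+ s * jac_row phi nk p (fun k i => 'd (hb k i) q v) j =
    - (lam v j * A j +
       (lam p j ^+ s * mu v j + s%:R * lam p j ^+ s.-1 * mu q j * lam v j) * B j).
  move=> v0.
  have := linearized_relation nk phi0 phi dphi0 dphi
    (expc nk s) (expu nk s) hb _ q v
    (differentiable_lam_expr_lam_mu s q j) (dhb q Mq) v0.
  rewrite diff_lam_expr_lam_mu/= q_lam q_mu WE -FE -jac_row_shift; apply.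
  have : nbhs q (miura nk s h @` M) by exact: open_nbhs_nbhs.
  apply: filterS => q' Mq'; apply: sepbar_rel_curve; last exact: relb.
  by case: Mq' => p' Mp' <-; exact: (lam_neq0 p' Mp').
(* The factor [lam ^+ s] from differentiating [mu] in [mub] cancels the one that multiplies the
   barred rows. *)
have hb_mu j : 'd (hb k i) q (e_mu R m alpha j) = 'd (h k i) p (e_mu R m alpha j).
  pose u k i := 'd (hb k i) q (e_mu R m alpha j).
  pose v k i := 'd (h k i) p (e_mu R m alpha j).
  suff uv : forall j', jac_row phi nk p u j' = jac_row phi nk p v j'.
    exact: (jac_row_inj _ _ _ u v (nondeg p Mp) uv k i ik).
  move=> j'.
  apply: (mulfI (expf_neq0 s (lam_neq0 p Mp j'))).
  have Eu := rowhb (e_mu R m alpha j) j' erefl.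
  have Ev := rowh (e_mu R m alpha j) j' erefl.
  rewrite [LHS]Eu [X in _ = _ * X]Ev lam_e_mu mu_e_mu; ring.
(* With [mub] fixed, [mu] has derivative [s * lam^-1 * mu] in [lam]; dividing by [lam ^+ s] gives
   both coefficients. Taking them at [j] alone suffices, since every row [j' != j] is zero. *)
have hb_lam j : 'd (hb k i) q (e_lam R m alpha j) =
   lam p j ^- s * 'd (h k i) p (e_lam R m alpha j) +
   s%:R * (lam p j)^-1 * lam p j ^- s * mu p j * 'd (h k i) p (e_mu R m alpha j).
  pose u k i := 'd (hb k i) q (e_lam R m alpha j).
  pose v k i := 'd (h k i) p (e_lam R m alpha j).
  pose w k i := 'd (h k i) p (e_mu R m alpha j).
  set X := lam p j ^- s; set Y := _ * mu p j.
  suff uv : forall j', jac_row phi nk p u j' =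
      jac_row phi nk p (fun k i => X * v k i + Y * w k i) j'.
    exact: (jac_row_inj _ _ _ u _ (nondeg p Mp) uv k i ik).
  move=> j'.
  have x0 := lam_neq0 p Mp j'.
  apply: (mulfI (expf_neq0 s x0)).
  have Eu := rowhb (e_lam R m alpha j) j' erefl.
  have Ev := rowh (e_lam R m alpha j) j' erefl.
  have Ew := rowh (e_mu R m alpha j) j' erefl.
  rewrite [LHS]Eu jac_row_comb [X in _ * (_ * X + _)]Ev [X in _ * (_ + _ * X)]Ew.
  rewrite /Y /X lam_e_mu mu_e_mu lam_e_lam mu_e_lam q_muE.
  have [->|_] := eqVneq j' j; last by rewrite mulr0n; ring.
  rewrite mulr1n.
  have -> : s%:R * lam p j ^+ s.-1 = s%:R * (lam p j ^+ s * (lam p j)^-1).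
    case: (s) => [|s']; first by rewrite !mul0r.
    by rewrite exprSr mulfK//; exact: lam_neq0.
  by field; rewrite expf_neq0 ?lam_neq0.
(* A direction in the [j]-th plane that annihilates the differential of the curve function makes all
   rows vanish, so it annihilates the differential of every Hamiltonian. *)
have comb0 j X Y : X * A j + Y * B j = 0 -> forall k' i', (i' < nk k')%N ->
    X * 'd (h k' i') p (e_lam R m alpha j) +
    Y * 'd (h k' i') p (e_mu R m alpha j) = 0.
  pose v k i := 'd (h k i) p (e_lam R m alpha j).
  pose w k i := 'd (h k i) p (e_mu R m alpha j).
  move=> AB; apply: (nondeg p Mp (fun k i => X * v k i + Y * w k i)) => j'.
  have Ev := rowh (e_lam R m alpha j) j' erefl.
  have Ew := rowh (e_mu R m alpha j) j' erefl.
  have := jac_row_comb phi nk p X Y v w j'; rewrite [X in _ * X + _]Ev.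
  rewrite [X in _ + _ * X]Ew lam_e_mu mu_e_mu lam_e_lam mu_e_lam => E.
  rewrite [LHS]E.
  have [->|_] := eqVneq j' j; last by rewrite mulr0n; ring.
  rewrite mulr1n.
  by rewrite !mul0r !mul1r addr0 add0r !mulrN -opprD AB oppr0.
(* Each summand of the bracket vanishes separately, as the gradients of both Hamiltonians in the
   [j]-th plane are controlled by [(A j, B j)]. *)
have invol k' i' : (i' < nk k')%N -> 'd (h k' i') p (ham_vf (h k i) p) = 0.
  move=> ik'; rewrite diff_ham_vf; apply: big1 => j _.
  exact: (det_annihilated_eq0 _ (A j) (B j) _ _ _ _
    (fun X Y AB => comb0 j X Y AB k i ik)
    (fun X Y AB => comb0 j X Y AB k' i' ik')).
set v := ham_vf (h k i) p.
have lam_v j : lam v j = 'd (h k i) p (e_mu R m alpha j) by exact: lam_ham_vf.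
have mu_v j : mu v j = - 'd (h k i) p (e_lam R m alpha j).
  exact: mu_ham_vf.
have v0 : v.2 = 0 by [].
have dv k' i' : (i' < nk k')%N -> 'd (h k' i') p v = 0 by exact: invol.
clearbody v.
have miura2E k' i' : (fun p' => (miura nk s h p').2 k' i') =
    fun p' => if (i' < s)%N then h k' (nk k' - 1 - i')%N p' else p'.2 k' i'.
  by apply/funext => p'; rewrite mxE.
have miura12E i' j : (fun p' => (miura nk s h p').1.2 i' j) =
    fun p' : pt R n m alpha => lam p' j ^- s * mu p' j.
  by apply/funext => p'; rewrite mxE.
have dmiura12 : differentiable (fun p' => (miura nk s h p').1.2) p.
  apply: differentiable_mx => i' j; rewrite miura12E.
  exact/differentiable_exprN_lam_mu/lam_neq0.
have dmiura11 : differentiable (fun p' => (miura nk s h p').1.1) p.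
  exact: (@differentiable_comp _ _ _ _ fst fst).
have dmiura1 : differentiable (fun p' => (miura nk s h p').1) p.
  exact: differentiable_pair.
have dcoord (k' : 'I_m) (i' : 'I_alpha) :
    is_diff p (fun p' : pt R n m alpha => p'.2 k' i' : R) (fun p' => p'.2 k' i').
  exact: (@is_diff_comp _ _ _ _ snd _ (fun B : 'M[R]_(m, alpha) => B k' i')).
have dmiura2 : differentiable (fun p' => (miura nk s h p').2) p.
  apply: differentiable_mx => k' i'; rewrite miura2E.
  case: (ltnP i' s) => // i's; apply: dh => //.
  have := ank k'; have := ltn_ord i'; lia.
have dmiura : differentiable (miura nk s h) p by exact: differentiable_pair.
rewrite (diff_pairE _ _ _ _ _ _ dmiura) (diff_pairE _ _ _ _ _ _ dmiura1) /ham_vf.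
congr (_, _, _).
- transitivity v.1.1.
    exact: (congr1 (@^~ _) (@diff_val _ _ _ _ _ _ _
      (@is_diff_comp _ _ _ _ fst _ fst _ _ _ _))).
  by apply/rowP => j; rewrite [RHS]mxE hb_mu; exact: lam_v.
(* The differential of [lam ^- s * mu] along [v] reproduces exactly the two terms of [hb_lam], with
   opposite sign. *)
- apply/rowP => j.
  rewrite (diff_mxE _ _ _ _ _ _ _ _ dmiura12).
  rewrite miura12E.
  apply: etrans (diff_exprN_lam_mu s p v j (lam_neq0 p Mp j)) _.
  rewrite [RHS]mxE hb_lam lam_v mu_v; ring.
(* New Casimirs with index below [s] are Hamiltonians, constant along [v] by involution; the others
   are old Casimirs, constant by [v0]. *)
- apply/matrixP => k' i'; rewrite (diff_mxE _ _ _ _ _ _ _ _ dmiura2) miura2E.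
  case: (ltnP i' s) => i's; last by rewrite diff_val v0 !mxE.
  by rewrite dv ?mxE//; have := ank k'; have := ltn_ord i'; lia.
Qed.
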